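(* If $A\in\mathbb{R}^{n\times n}$ is principally simple, then $|\Pi(A)|\equiv 1\pmod 2$.
   Context: For $A\in\mathbb{R}^{n\times n}$ ($n\ge 1$), a real number $\lambda$ is a Pareto eigenvalue of $A$ if there exists $x\in\mathbb{R}^n\setminus\{0\}$ with $x\ge 0$, $Ax-\lambda x\ge 0$ (componentwise) and $\langle x,Ax-\lambda x\rangle=0$; $\Pi(A)$ is the set of Pareto eigenvalues of $A$. For nonempty $J\subseteq\{1,\dots,n\}$, $A_J$ is the principal submatrix indexed by $J$. The matrix $A$ is principally simple if (i) for every nonempty $J$, every real eigenvalue of $A_J$ is algebraically simple, and (ii) for any two distinct nonempty index sets $J\ne K$, the matrices $A_J$ and $A_K$ have no common real eigenvalue. *)

(* Defs.v *)
From mathcomp Require Import all_boot all_order all_algebra.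
From mathcomp Require Import all_classical all_reals.

Set Implicit Arguments.
Unset Strict Implicit.
Unset Printing Implicit Defensive.

Import Order.TTheory GRing.Theory Num.Theory.
Local Open Scope ring_scope.
Local Open Scope classical_set_scope.

Definition is_pareto_eigenvalue (R : realType) (n : nat) (A : 'M[R]_n)
    (lambda : R) : Prop :=
  exists x : 'cV[R]_n,
    [/\ x != 0,
        forall i, 0 <= x i 0,
        forall i, 0 <= (A *m x - lambda *: x) i 0
      & \sum_i x i 0 * (A *m x - lambda *: x) i 0 = 0].

Definition pareto_spectrum (R : realType) (n : nat) (A : 'M[R]_n) : set R :=
  [set lambda | is_pareto_eigenvalue A lambda].

(* Rows and columns of A indexed by J, taken in increasing order (enum_val). *)
Definition principal_submx (R : realType) (n : nat) (A : 'M[R]_n)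
    (J : {set 'I_n}) : 'M[R]_#|J| :=
  mxsub (fun i : 'I_#|J| => enum_val i) (fun i : 'I_#|J| => enum_val i) A.

Definition alg_simple (R : realType) (m : nat) (M : 'M[R]_m) (a : R) : Prop :=
  mup a (char_poly M) = 1%N.

(* The library's eigenvalue quantifies over row (left) eigenvectors; a square
   matrix has the same left and right eigenvalues. *)
Definition principally_simple (R : realType) (n : nat) (A : 'M[R]_n) : Prop :=
  (forall J : {set 'I_n}, J != finset.set0 ->
     forall a : R, eigenvalue (principal_submx A J) a ->
       alg_simple (principal_submx A J) a) /\
  (forall J K : {set 'I_n}, J != finset.set0 -> K != finset.set0 -> J != K ->
     ~ exists a : R, eigenvalue (principal_submx A J) a /\
                     eigenvalue (principal_submx A K) a).

(* Main.v *)
(* For a matrix C let B_J be the matrix whose columns are those of C for j in J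
   and those of the identity for j outside J. When all B_J are invertible, the
   number of J with B_J^{-1} q > 0 (the solutions of a linear complementarity
   problem) has a parity independent of the generic vector q, a degree mod 2 of C.
   For C = x I - A, det B_J is the characteristic polynomial of A_J at x, so the
   degree is constant in x away from the eigenvalues of the A_J. At a simple
   eigenvalue of a single A_J, det B_J changes sign, and J is counted on exactly
   one side if the kernel vector adj(B_J) q of B_J has all its entries of the same
   sign, which means that x is a Pareto eigenvalue, and on neither side
   otherwise. The degree is 1 for x near -oo and 0 for x near +oo, so it
   jumps an odd number of times. *)
Require Import Defs.
From mathcomp Require Import all_boot all_order all_algebra finmap.
From mathcomp Require Import all_classical all_reals.
From mathcomp Require Import polyrcf lra.

Set Implicit Arguments.
Unset Strict Implicit.
Unset Printing Implicit Defensive.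

Import Order.TTheory GRing.Theory Num.Theory.
Local Open Scope ring_scope.

(** * Generic vectors and sign changes along a segment *)

Lemma poly_exists_nonroot (R : numDomainType) (p : {poly R}) :
  p != 0 -> exists s : R, p.[s] != 0.
Proof.
move=> p0; apply: contrapT => /forallNP noroot.
have : (size [seq k%:R : R | k <- iota 0 (size p)] < size p)%N.
  apply: max_poly_roots => //.
    by apply/allP => s _; have /negP := noroot s; rewrite negbK.
  by rewrite map_inj_uniq ?iota_uniq // => i j /eqP; rewrite eqr_nat => /eqP.
by rewrite size_map size_iota ltnn.
Qed.

(* A vector on the moment curve avoids finitely many hyperplanes. *)
Lemma exists_generic_vector (R : numFieldType) n (I : finType)
    (r : I -> 'rV[R]_n) :
  (forall i, r i != 0) -> exists q : 'cV[R]_n, forall i, (r i *m q) 0 0 != 0.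
Proof.
move=> r0.
have [s] : exists s : R, (\prod_i rVpoly (r i)).[s] != 0.
  apply: poly_exists_nonroot; apply/prodf_neq0 => i _.
  apply: contra (r0 i) => /eqP ri0.
  by rewrite -[r i]rVpolyK ri0 linear0.
rewrite horner_prod => /prodf_neq0 s0.
exists (\col_i s ^+ i) => i; have := s0 i isT.
suff -> : (r i *m \col_j s ^+ j) 0 0 = (rVpoly (r i)).[s] by [].
by rewrite mxE horner_poly; apply: eq_bigr => j _; rewrite mxE valK.
Qed.

(* Going through [s] in order of the times [T k] at which the sign of [k] flips
   from [al k] to [be k], the conjunction of all signs telescopes. *)
Lemma telescope_sign_flips (disp : Order.disp_t) (S : orderType disp)
    (I : eqType) (T : I -> S) (al be : pred I) (pos : I -> I -> bool)
    (s : seq I) :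
  sorted (relpre T <=%O) s -> uniq s ->
  (forall k j, al k != be k -> j != k ->
     pos k j = if (T k <= T j)%O then al j else be j) ->
  (forall k j, al k != be k -> al j != be j -> k != j -> T k != T j) ->
  all al s (+) all be s =
  odd (count (fun k => (al k != be k) && all (fun j => (j != k) ==> pos k j) s) s).
Proof.
move=> sorted_s uniq_s posE Tneq; elim: s sorted_s uniq_s => [|k s IHs] //=.
move=> path_s /andP[ks uniq_s].
have Tk j : j \in s -> (T k <= T j)%O.
  move=> js; have tr : transitive (relpre T <=%O).
    by move=> ? ? ?; apply: le_trans.
  exact: (allP (order_path_min tr path_s)) j js.
have neqk j : j \in s -> j != k by apply: contraTneq => ->.
(* At any later flip the head [k] already has its final sign [be k], while at the flip of [k] itself
   all other entries still have their initial sign [al]. *)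
rewrite eqxx /= oddD.
rewrite (@eq_in_count _ _ (fun k' => be k && ((al k' != be k') &&
    all (fun j => (j != k') ==> pos k' j) s))); last first.
  move=> k' k's /=; rewrite [k == _]eq_sym (neqk _ k's) /=.
  case: (boolP (al k' != be k')) => //= alk'; last by rewrite andbF.
  congr (_ && _); rewrite (posE _ _ alk') 1?eq_sym ?neqk //.
  case: (eqVneq (al k) (be k)) => [-> | alk]; first by rewrite if_same.
  have := Tneq _ _ alk' alk (neqk _ k's).
  by rewrite leNgt lt_neqAle (Tk _ k's) eq_sym andbT => ->.
have -> : (al k != be k) && all (fun j => (j != k) ==> pos k j) s =
          (al k != be k) && all al s.
  case: (boolP (al k != be k)) => //= alk; apply: eq_in_all => j js.
  by rewrite neqk //= posE ?neqk // Tk.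
have -> : odd (count (fun k' => be k && ((al k' != be k') &&
    all (fun j => (j != k') ==> pos k' j) s)) s) =
    be k && (all al s (+) all be s).
  rewrite IHs ?(path_sorted path_s) //; case: (be k) => //=.
  by rewrite count_pred0.
by rewrite oddb; case: (al k) (be k) (all al s) (all be s) => [] [] [] [].
Qed.

(** A coordinate whose end signs differ vanishes exactly once along the segment. The last hypothesis
    makes these times distinct, so sorting the coordinates by time reduces the claim to
    [telescope_sign_flips]. *)
Lemma odd_segment_crossings (R : realFieldType) n (a b : 'cV[R]_n) :
  (forall i, a i 0 != 0) -> (forall i, b i 0 != 0) ->
  (forall i j, i != j -> a i 0 * b j 0 != a j 0 * b i 0) ->
  [forall i, 0 < a i 0] (+) [forall i, 0 < b i 0] =
  odd #|[pred i | `[< exists t, [/\ 0 < t < 1,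
                                 ((1 - t) *: a + t *: b) i 0 = 0 &
                   forall j, j != i -> 0 < ((1 - t) *: a + t *: b) j 0] >]]|.
Proof.
(* [T i] solves (1 - t) a_i + t b_i = 0. It lies in ]0, 1[ when the signs at the ends differ;
   otherwise its value is irrelevant, as [al i] and [be i] agree. *)
move=> a0 b0 ab; pose T i := a i 0 / (a i 0 - b i 0).
pose al i := 0 < a i 0; pose be i := 0 < b i 0.
pose pos k j := 0 < (1 - T k) * a j 0 + T k * b j 0.
have flip k : al k != be k ->
    [/\ a k 0 - b k 0 != 0, a k 0 = T k * (a k 0 - b k 0) & 0 < T k < 1].
  rewrite /al /be => alk.
  have abk : a k 0 - b k 0 != 0.
    by apply: contraNneq alk => /subr0_eq ->.
  have aE : a k 0 = T k * (a k 0 - b k 0) by rewrite /T divfK.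
  split => //; move: alk aE abk; set x := a k 0; set y := b k 0; set t := T k.
  have [x0 | x0 | x0] := ltrgtP 0 x; have [y0 | y0 | y0] := ltrgtP 0 y => //= _.
  - by move=> tE _; apply/andP; split; nra.
  - by have := b0 k; rewrite -/y -y0 eqxx.
  - by move=> tE _; apply/andP; split; nra.
  - by have := a0 k; rewrite -/x -x0 eqxx.
have Tneq k j : al k != be k -> al j != be j -> k != j -> T k != T j.
  move=> /flip[_ ak _] /flip[_ aj /andP[tj0 _]] kj.
  apply: contra (ab _ _ kj) => /eqP Tkj; apply/eqP.
  rewrite Tkj in ak; apply: (mulfI (lt0r_neq0 tj0)).
  have := congr1 ( *%R (a k 0)) aj; have := congr1 ( *%R (a j 0)) ak; lra.
have posE k j : al k != be k -> j != k ->
    pos k j = if T k <= T j then al j else be j.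
  move=> alk jk; have [abk ak /andP[tk0 tk1]] := flip _ alk; rewrite /pos.
  case: (eqVneq (al j) (be j)) => [albe|albe].
    rewrite albe if_same; move: albe (a0 j) (b0 j); rewrite /al /be.
    set x := a j 0; set y := b j 0; set t := T k in tk0 tk1 *.
    rewrite !neq_lt; have [y0|y0|//] := ltrgtP 0 y => + /orP[]x0 _.
    + by rewrite ltNge ltW.
    + by move=> _; apply/idP; nra.
    + by move=> _; apply/negbTE; rewrite -leNgt; nra.
    + by rewrite x0.
  have [abj aj /andP[tj0 tj1]] := flip _ albe.
  have Tkj : T k != T j by apply: Tneq; rewrite // eq_sym.
  have -> : (1 - T k) * a j 0 + T k * b j 0 = (T j - T k) * (a j 0 - b j 0).
    by move: aj; nra.
  move: albe (a0 j) (b0 j); rewrite /al /be.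
  set x := a j 0; set y := b j 0.
  have [x0 | x0 | x0] := ltrgtP 0 x; have [y0 | y0 | y0] := ltrgtP 0 y => //= _ _ _.
  - case: (leP (T k)) => Tle; last by apply/negbTE; rewrite -leNgt; nra.
    by apply: mulr_gt0; rewrite subr_gt0 ?(lt_trans y0) // lt_neqAle Tkj.
  - case: (leP (T k)) => Tle; first by apply/negbTE; rewrite -leNgt; nra.
    by apply/idP; nra.
pose s := sort (relpre T <=%R) (enum 'I_n).
have sE : s =i predT by move=> i; rewrite mem_sort mem_enum.
have allE (P : pred 'I_n) : [forall i, P i] = all P s.
  by apply/forallP/allP => [HP i _|HP i]; apply: HP; rewrite ?sE.
rewrite !allE (@telescope_sign_flips _ _ _ T al be pos) //; first last.
- by rewrite sort_uniq enum_uniq.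
- by apply: sort_sorted => i j; apply: le_total.
congr odd; rewrite cardE size_filter -enumT /s count_sort.
apply: eq_count => i; apply/andP/asboolP => [[ali /allP posi]|].
  have [abi ai ti] := flip _ ali; exists (T i); split => //.
    by rewrite !mxE; move: ai; nra.
  by move=> j ji; have := posi j; rewrite !mxE sE ji => /(_ isT).
move=> [t [/andP[t0 t1]]]; rewrite !mxE => ti post.
have ali : al i != be i.
  move: ti (a0 i) (b0 i); rewrite /al /be; set x := a i 0; set y := b i 0.
  by have [x0 | x0 | //] := ltrgtP 0 x; have [y0 | y0 | //] := ltrgtP 0 y => //=; nra.
have [abi ai _] := flip _ ali.
have Tit : T i = t by apply: (mulIf abi); rewrite -ai; nra.
split=> //; apply/allP => j _; apply/implyP => ji.
by have := post j ji; rewrite /pos !mxE Tit.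
Qed.

(** * Complementary bases and their determinants *)

Lemma det_addmx1_mulmxC (F : comNzRingType) n m (X : 'M[F]_(n, m))
    (Y : 'M[F]_(m, n)) : \det (1%:M + X *m Y) = \det (1%:M + Y *m X).
Proof.
(* Sylvester's identity: two triangular factorizations of the same block matrix have the two sides
   as determinants. *)
pose M := block_mx 1%:M (- X) Y 1%:M.
have EX : M = block_mx (1%:M + X *m Y) (- X) 0 1%:M *m block_mx 1%:M 0 Y 1%:M.
  rewrite mulmx_block ?(mulmx1, mul1mx, mulmx0, mul0mx, add0r, addr0) mulNmx.
  by rewrite addrK.
have EY : M = block_mx 1%:M 0 Y 1%:M *m block_mx 1%:M (- X) 0 (1%:M + Y *m X).
  rewrite mulmx_block ?(mulmx1, mul1mx, mulmx0, mul0mx, add0r, addr0) mulmxN.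
  by rewrite addrC addrK.
have := congr1 determinant EX; rewrite EY !det_mulmx !det_ublock !det_lblock.
by rewrite !det1 !mul1r !mulr1 => ->.
Qed.

(* The complementary basis of the linear complementarity problem [(C, q)] at
   [J]: a pair [z, w >= 0] with [w + C z = q], [z] supported in [J] and [w]
   supported outside [J] is a nonnegative solution [u] of [B_J u = q]. *)
Definition compl_basis (F : nzRingType) n (C : 'M[F]_n) (J : {set 'I_n}) :
    'M[F]_n :=
  \matrix_(i, j) (if j \in J then C i j else (i == j)%:R).

Definition flip n (J : {set 'I_n}) (i : 'I_n) : {set 'I_n} :=
  if i \in J then J :\ i else i |: J.

Lemma in_flip n (J : {set 'I_n}) i j :
  (j \in flip J i) = if j == i then i \notin J else j \in J.
Proof.
by rewrite /flip; case: ifP => iJ; rewrite !inE; case: eqP => // ->.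
Qed.

Lemma flipK n (i : 'I_n) : involutive (fun J => flip J i).
Proof.
move=> J; apply/setP => j; rewrite !in_flip eqxx negbK.
by case: eqP => // ->.
Qed.

Lemma flip_neq n (J : {set 'I_n}) i : flip J i != J.
Proof.
by apply/eqP => /setP/(_ i); rewrite in_flip eqxx; case: (i \in J).
Qed.

Lemma compl_basis_set0 (F : nzRingType) n (C : 'M[F]_n) :
  compl_basis C finset.set0 = 1%:M.
Proof. by apply/matrixP => i j; rewrite !mxE inE. Qed.

(** [V] selects the coordinates in [J], and B_J = 1 + ((C - 1) V) V^T. Exchanging the two factors
    under the determinant leaves 1 + V^T (C - 1) V, which is the principal submatrix. *)
Lemma det_compl_basis (F : comNzRingType) n (C : 'M[F]_n) (J : {set 'I_n}) :
  \det (compl_basis C J) =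
  \det (mxsub (fun i : 'I_#|J| => enum_val i) (fun i : 'I_#|J| => enum_val i) C).
Proof.
pose V : 'M[F]_(n, #|J|) := \matrix_(i, k) (i == enum_val k)%:R.
have VE m (W : 'M[F]_(m, n)) i k : (W *m V) i k = W i (enum_val k).
  rewrite mxE (bigD1 (enum_val k)) //= !mxE eqxx mulr1 big1 ?addr0 // => j jk.
  by rewrite !mxE (negbTE jk) mulr0.
have VTE m (W : 'M[F]_(n, m)) k i : (V^T *m W) k i = W (enum_val k) i.
  rewrite mxE (bigD1 (enum_val k)) //= !mxE eqxx mul1r big1 ?addr0 // => j jk.
  by rewrite !mxE (negbTE jk) mul0r.
have -> : compl_basis C J = 1%:M + ((C - 1%:M) *m V) *m V^T.
  apply/matrixP => i j; rewrite !mxE.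
  case: ifPn => jJ.
    have [k <-] : exists k : 'I_#|J|, enum_val k = j.
      by exists (enum_rank_in jJ j); rewrite enum_rankK_in.
    rewrite (bigD1 k) //= VE !mxE eqxx mulr1 big1 => [|l lk].
      by rewrite addr0 addrC subrK.
    by rewrite !mxE (inj_eq enum_val_inj) eq_sym (negbTE lk) mulr0.
  rewrite big1 ?addr0 // => k _; rewrite !mxE; case: eqP => [jk|]; rewrite ?mulr0 //.
  by move: jJ; rewrite jk enum_valP.
rewrite det_addmx1_mulmxC; congr determinant; apply/matrixP => i j.
rewrite mxE VTE VE !mxE (inj_eq enum_val_inj).
by rewrite addrC subrK.
Qed.

Lemma mulmx_compl_basis_flip (F : nzRingType) n m (C : 'M[F]_n) J i
    (u : 'M[F]_(n, m)) :
  (forall k, u i k = 0) -> compl_basis C (flip J i) *m u = compl_basis C J *m u.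
Proof.
move=> ui; apply/matrixP => k l; rewrite !mxE; apply: eq_bigr => j _.
rewrite !mxE in_flip; case: eqP => // ->.
by rewrite ui !mulr0.
Qed.

(** Cramer's rule: the cofactors along column [i] do not see column [i], the only one in which the
    two bases differ. *)
Lemma adj_compl_basis_flip (F : comNzRingType) n (C : 'M[F]_n) J i :
  (\adj (compl_basis C J) *m compl_basis C (flip J i)) i i =
  \det (compl_basis C (flip J i)).
Proof.
rewrite (expand_det_col _ i) mxE; apply: eq_bigr => k _.
rewrite mulrC; congr (_ * _); rewrite mxE /cofactor; congr (_ * \det _).
apply/matrixP => k' l; rewrite !mxE in_flip.
by rewrite [_ == i]eq_sym (negbTE (neq_lift _ _)).
Qed.

(** * Parity of the number of solutions of a linear complementarity problem *)

Definition lcp_nondegenerate (F : fieldType) n (C : 'M[F]_n) (q : 'cV[F]_n) :=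
  forall J i, (invmx (compl_basis C J) *m q) i 0 != 0.

(** [invmx] leaves singular matrices unchanged, so this is the solution set only where all bases are
    invertible. For nondegenerate [q], strict positivity amounts to nonnegativity. *)
Definition lcp_solutions (F : numFieldType) n (C : 'M[F]_n) (q : 'cV[F]_n) :
    {set {set 'I_n}} :=
  finset (fun J => [forall i, 0 < (invmx (compl_basis C J) *m q) i 0]).

(** Flipping [i] pairs the sets that contain [i] with those that do not. *)
Lemma sum_flip_even n (i : 'I_n) (P : pred {set 'I_n}) :
  (forall J, P (flip J i) = P J) -> ~~ odd (\sum_J P J)%N.
Proof.
move=> PE; rewrite (bigID (fun J : {set 'I_n} => i \in J)) /=.
rewrite (reindex_inj (inv_inj (@flipK n i))) /=.
rewrite (eq_big (fun J : {set 'I_n} => i \notin J) (fun J => P J : nat)).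
- by rewrite addnn odd_double.
- by move=> J; rewrite in_flip eqxx.
- by move=> J _; rewrite PE.
Qed.

(* Along a generic segment from [q1] to [q2], a solution [J] can only appear or
   disappear when coordinate [i] vanishes, which it then does simultaneously
   for [J] and [flip J i]. *)
Lemma odd_lcp_solutions_transverse (F : realFieldType) n (C : 'M[F]_n) q1 q2 :
  (forall J, compl_basis C J \in unitmx) ->
  lcp_nondegenerate C q1 -> lcp_nondegenerate C q2 ->
  (forall J i j, i != j ->
     (invmx (compl_basis C J) *m q1) i 0 * (invmx (compl_basis C J) *m q2) j 0 !=
     (invmx (compl_basis C J) *m q1) j 0 * (invmx (compl_basis C J) *m q2) i 0) ->
  odd #|lcp_solutions C q1| = odd #|lcp_solutions C q2|.
Proof.
move=> unitB nd1 nd2 transv.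
pose cross J i := `[< exists t, [/\ 0 < t < 1,
    (invmx (compl_basis C J) *m ((1 - t) *: q1 + t *: q2)) i 0 = 0 &
    forall j, j != i ->
      0 < (invmx (compl_basis C J) *m ((1 - t) *: q1 + t *: q2)) j 0] >].
have crossE J : (J \in lcp_solutions C q1) (+) (J \in lcp_solutions C q2) =
    odd (\sum_i cross J i)%N.
  rewrite !inE (odd_segment_crossings (nd1 J) (nd2 J)); last exact: transv.
  rewrite -sum1_card big_mkcond /=; congr odd; apply: eq_bigr => i _.
  rewrite inE /cross; under [in RHS]eq_exists => t.
    rewrite mulmxDr -!scalemxAr; over.
  by case: asboolP.
have cross_flip i J : cross (flip J i) i = cross J i.
  have crossW K : cross K i -> cross (flip K i) i.
    move=> /asboolP[t [t01 ti tj]]; apply/asboolP; exists t.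
    set p := (1 - t) *: q1 + t *: q2 in ti tj *.
    set u := invmx (compl_basis C K) *m p in ti tj.
    suff -> : invmx (compl_basis C (flip K i)) *m p = u by [].
    rewrite -[p](mulKVmx (unitB K)) -/u -(@mulmx_compl_basis_flip _ _ _ _ _ i) ?mulKmx //.
    by move=> k; rewrite ord1.
  by apply/idP/idP => /crossW //; rewrite flipK.
have oddS (I : finType) (f : I -> nat) :
    odd (\sum_k f k)%N = \big[addb/false]_k odd (f k).
  exact: (big_morph odd oddD).
have cardE (A : {set {set 'I_n}}) : #|A| = (\sum_J (J \in A))%N.
  by rewrite -sum1_card big_mkcond; apply: eq_bigr => J _; case: ifP.
(* Modulo 2, the difference of the two counts is the number of all crossings [(J, i)]; for fixed [i]
   these are paired by [flip]. *)
apply/eqP; rewrite -[_ == _]negbK negb_eqb -oddD.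
rewrite !cardE -big_split /= oddS.
rewrite (eq_bigr (fun J => odd (\sum_i cross J i)%N)) => [|J _]; last first.
  by rewrite -crossE oddD !oddb.
rewrite -oddS exchange_big oddS big1 // => i _.
apply/negbTE/(@sum_flip_even _ i).
by move=> J; apply: cross_flip.
Qed.

(** An intermediate [q] off finitely many hyperplanes is nondegenerate and joined to both [q1] and
    [q2] by transverse segments. *)
Lemma odd_lcp_solutions (F : realFieldType) n (C : 'M[F]_n) q1 q2 :
  (forall J, compl_basis C J \in unitmx) ->
  lcp_nondegenerate C q1 -> lcp_nondegenerate C q2 ->
  odd #|lcp_solutions C q1| = odd #|lcp_solutions C q2|.
Proof.
move=> unitB nd1 nd2.
pose B J := invmx (compl_basis C J).
(* The rows with [i == j] encode nondegeneracy of [q]; the others encode transversality of the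
   segment from [q1] or [q2], as chosen by [b]. *)
pose r (e : bool * {set 'I_n} * 'I_n * 'I_n) : 'rV[F]_n :=
  let: (b, J, i, j) := e in let a := B J *m (if b then q1 else q2) in
  if i == j then row i (B J) else a i 0 *: row j (B J) - a j 0 *: row i (B J).
have rowB J i : row i (B J) *m compl_basis C J = delta_mx 0 i.
  by rewrite -row_mul mulVmx // row1.
have [|q rq] := @exists_generic_vector _ _ _ r.
  move=> [[[b J] i] j] /=; case: (eqVneq i j) => [_|ij]; apply/negP => /eqP.
    move=> /(congr1 (fun M => M *m compl_basis C J)); rewrite rowB mul0mx.
    by move/matrixP/(_ 0 i)/eqP; rewrite !mxE !eqxx oner_eq0.
  move=> /(congr1 (fun M => M *m compl_basis C J)).
  rewrite mulmxBl -!scalemxAl !rowB mul0mx => /matrixP/(_ 0 j)/eqP.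
  rewrite !mxE !eqxx [j == i]eq_sym (negbTE ij) mulr0 mulr1 subr0.
  by apply/negP; case: b; [have := nd1 J i | have := nd2 J i]; rewrite mxE.
have rowE J i (u : 'cV[F]_n) : (row i (B J) *m u) 0 0 = (B J *m u) i 0.
  by rewrite -row_mul mxE.
have linE (x y : F) (u w : 'M[F]_1) :
    (x *: u - y *: w) 0 0 = x * u 0 0 - y * w 0 0 by rewrite !mxE.
have ndq : lcp_nondegenerate C q.
  by move=> J i; have := rq (true, J, i, i); rewrite /= eqxx rowE.
have transv b J i j : i != j ->
    (B J *m (if b then q1 else q2)) i 0 * (B J *m q) j 0 !=
    (B J *m (if b then q1 else q2)) j 0 * (B J *m q) i 0.
  move=> ij; have := rq (b, J, i, j); rewrite /= (negbTE ij) mulmxBl -!scalemxAl.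
  by rewrite linE !rowE subr_eq0.
transitivity (odd #|lcp_solutions C q|).
  by apply: odd_lcp_solutions_transverse => // J i j; apply: (transv true).
by apply/esym/odd_lcp_solutions_transverse => // J i j; apply: (transv false).
Qed.

(** * Adjugates of the bases, and Pareto eigenvectors as kernel vectors *)

Lemma adj_compl_basis_row_neq0 (F : fieldType) n (C : 'M[F]_n) J i :
  (forall K, \det (compl_basis C J) = 0 -> \det (compl_basis C K) = 0 -> J = K) ->
  row i (\adj (compl_basis C J)) != 0.
Proof.
move=> uniq0; apply/eqP => row0.
(* A zero row makes the diagonal entry [i] of the adjugate times any matrix vanish; applied to the
   bases at [J] and [flip J i], this gives two singular bases. *)
have adj0 (M : 'M[F]_n) : (\adj (compl_basis C J) *m M) i i = 0.
  by have /matrixP/(_ 0 i) := row_mul i (\adj (compl_basis C J)) M;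
     rewrite row0 mul0mx !mxE.
have det0 : \det (compl_basis C J) = 0.
  by have := adj0 (compl_basis C J); rewrite mul_adj_mx mxE eqxx.
have /eqP := uniq0 _ det0 (etrans (esym (adj_compl_basis_flip C J i)) (adj0 _)).
by rewrite eq_sym (negbTE (flip_neq J i)).
Qed.

Lemma invmx_gt0 (F : numFieldType) n (B : 'M[F]_n) (q : 'cV[F]_n) i :
  \det B \is Num.real -> \det B != 0 ->
  (0 < (invmx B *m q) i 0) = (0 < \det B * (\adj B *m q) i 0).
Proof.
move=> realB B0; rewrite /invmx unitmxE unitfE B0 -scalemxAl mxE.
rewrite -[in RHS](pmulr_rgt0 _ (_ : 0 < (\det B)^-1 ^+ 2)) ?exprn_even_gt0 //.
  by rewrite expr2 -mulrA mulKf.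
by rewrite real_exprn_even_gt0 ?invr_eq0 ?B0 ?orbT // realV.
Qed.

Lemma invmx_neq0 (F : fieldType) n (B : 'M[F]_n) (q : 'cV[F]_n) i :
  \det B != 0 -> ((invmx B *m q) i 0 != 0) = ((\adj B *m q) i 0 != 0).
Proof.
move=> B0; rewrite /invmx unitmxE unitfE B0 -scalemxAl mxE.
by rewrite mulf_eq0 invr_eq0 (negbTE B0).
Qed.

Lemma mulmx_compl_basis (F : nzRingType) n (C : 'M[F]_n) J (v : 'cV[F]_n) :
  compl_basis C J *m v = C *m (\col_i if i \in J then v i 0 else 0) +
                         \col_i if i \in J then 0 else v i 0.
Proof.
apply/matrixP => k l; rewrite ord1 !mxE (bigID (fun j => j \in J)) /=.
congr (_ + _).
  rewrite big_mkcond; apply: eq_bigr => j _; rewrite !mxE.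
  by case: (j \in J); rewrite ?mulr0.
rewrite big_mkcond (bigD1 k) //= big1 ?addr0 => [|j jk]; last first.
  by rewrite !mxE; case: (j \in J) => //=; rewrite [k == j]eq_sym (negbTE jk) mul0r.
by rewrite !mxE eqxx; case: (k \in J) => //; apply: mul1r.
Qed.

(** The parts [z] of [v] in [J] and [w] outside [J] satisfy A z - x z = w and have disjoint
    supports, so [z] is a Pareto eigenvector. *)
Lemma pareto_of_compl_basis (R : realType) n (A : 'M[R]_n) x J (v : 'cV[R]_n) :
  J != finset.set0 -> compl_basis (x%:M - A) J *m v = 0 ->
  (forall i, 0 < v i 0) -> is_pareto_eigenvalue A x.
Proof.
move=> /set0Pn[k kJ]; rewrite mulmx_compl_basis mulmxBl mul_scalar_mx.
set z := \col_i _; set w := \col_i _ => /eqP; rewrite addr_eq0 => /eqP zw v0.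
have {}zw : A *m z - x *: z = w by rewrite -opprB zw opprK.
exists z; rewrite zw; split.
- apply/eqP => /matrixP/(_ k 0)/eqP; rewrite !mxE kJ.
  by rewrite (negbTE (lt0r_neq0 (v0 k))).
- by move=> i; rewrite mxE; case: ifP => // _; apply: ltW.
- by move=> i; rewrite mxE; case: ifP => // _; apply: ltW.
- by apply: big1 => i _; rewrite !mxE; case: ifP; rewrite ?mulr0 ?mul0r.
Qed.

(** Take for [J] the support of the Pareto eigenvector [z], and v = z + w with w = A z - x z;
    complementarity makes [w] vanish on [J]. *)
Lemma compl_basis_of_pareto (R : realType) n (A : 'M[R]_n) x :
  is_pareto_eigenvalue A x -> exists (J : {set 'I_n}) (v : 'cV[R]_n),
    [/\ forall i, 0 <= v i 0, exists2 k, k \in J & 0 < v k 0 &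
        compl_basis (x%:M - A) J *m v = 0].
Proof.
case=> z [z0 zge0]; set w := A *m z - x *: z => wge0 zw.
pose J : {set 'I_n} := finset (fun i => 0 < z i 0); exists J, (z + w).
have zw0 i : z i 0 * w i 0 = 0.
  have zwge0 j : true -> 0 <= z j 0 * w j 0 by move=> _; apply: mulr_ge0.
  by have /eqP := zw; rewrite psumr_eq0 // => /allP/(_ i (mem_index_enum _))/eqP.
have zJ i : i \notin J -> z i 0 = 0.
  by rewrite inE -leNgt => zi; apply/eqP; rewrite eq_le zi zge0.
have wJ i : i \in J -> w i 0 = 0.
  rewrite inE => zi; have /eqP := zw0 i.
  by rewrite mulf_eq0 (negbTE (lt0r_neq0 zi)) => /eqP.
split.
- by move=> i; rewrite mxE addr_ge0.
- have [k zk] : exists k, z k 0 != 0.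
    apply: contrapT => /forallNP zz; move/eqP: z0; apply.
    by apply/matrixP => i j; rewrite ord1 mxE; apply/eqP; have /negP := zz i; rewrite negbK.
  have kJ : k \in J by rewrite inE lt_def zk zge0.
  by exists k => //; rewrite mxE wJ // addr0; move: kJ; rewrite inE.
- rewrite mulmx_compl_basis mulmxBl mul_scalar_mx.
  have -> : (\col_i if i \in J then (z + w) i 0 else 0) = z.
    by apply/matrixP => i j; rewrite ord1 !mxE; case: ifPn => [/wJ|/zJ ->]; rewrite ?mxE // => ->; rewrite addr0.
  have -> : (\col_i if i \in J then 0 else (z + w) i 0) = w.
    by apply/matrixP => i j; rewrite ord1 !mxE; case: ifPn => [/wJ|/zJ]; rewrite ?mxE // => ->; rewrite ?add0r.
  by rewrite -opprB addNr.
Qed.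

(** * Local constancy and connectedness on the real line *)

Lemma sgr_horner_near (R : rcfType) (ps : seq {poly R}) (x : R) :
  (forall p, p \in ps -> p.[x] != 0) ->
  exists2 e, 0 < e & forall y, `|y - x| < e ->
    forall p, p \in ps -> Num.sg p.[y] = Num.sg p.[x].
Proof.
elim: ps => [|p ps IHps] ps0; first by exists 1.
have [|e e0 eP] := IHps; first by move=> q qps; apply: ps0; rewrite inE qps orbT.
have px0 : p.[x] != 0 by apply: ps0; rewrite inE eqxx.
have [|d d0 dP] := @poly_cont _ x p `|p.[x]|; first by rewrite normr_gt0.
exists (Num.min e d); first by rewrite lt_min e0.
move=> y; rewrite lt_min => /andP[ye yd] q; rewrite inE => /orP[/eqP ->|]; last exact: eP.
have := dP y yd; rewrite ltr_norml.
have [p0 | p0 | p0] := ltrgtP p.[x] 0.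
- rewrite (ltr0_norm p0) opprK => /andP[_ py]; rewrite !ltr0_sg //; lra.
- rewrite (gtr0_norm p0) => /andP[py _]; rewrite !gtr0_sg //; lra.
- by rewrite p0 eqxx in px0.
Qed.

(** The punctured germ of [g] forgets its values at exceptional points and is locally constant
    everywhere, hence constant because the line is connected. *)
Lemma eq_ends_of_punctured_const (R : realType) (g : R -> bool) L1 L2 b1 b2 :
  (forall x, exists b, exists2 e, 0 < e &
     forall y, y != x -> `|y - x| < e -> g y = b) ->
  (forall y, y < L1 -> g y = b1) -> (forall y, L2 < y -> g y = b2) -> b1 = b2.
Proof.
move=> g_const gL1 gL2.
pose germ b x := exists2 e, 0 < e & forall y, y != x -> `|y - x| < e -> g y = b.
have germ_near b x : germ b x ->
    exists2 e, 0 < e & forall y, `|y - x| < e -> germ b y.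
  move=> [e e0 eP]; exists e => // y yx.
  have [-> | yneqx] := eqVneq y x; first by exists e.
  have d0 : 0 < `|y - x| by rewrite normr_gt0 subr_eq0.
  exists (Num.min `|y - x| (e - `|y - x|)); first by rewrite lt_min d0 subr_gt0.
  move=> z _; rewrite lt_min => /andP[zy1 zy2]; apply: eP.
    by apply: contraTneq zy1 => ->; rewrite distrC ltxx.
  by have := ler_distD y z x; lra.
have germ_uniq b b' x : germ b x -> germ b' x -> b = b'.
  move=> [e e0 eP] [e' e'0 eP']; pose d := Num.min e e' / 2.
  have d0 : 0 < d by rewrite divr_gt0 // lt_min e0.
  have [de de'] : d < e /\ d < e'.
    by apply/andP; rewrite -lt_min /d; move: d0; rewrite /d; lra.
  have dx : x + d != x by rewrite -subr_eq0 addrC addKr lt0r_neq0.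
  by rewrite -(eP (x + d)) ?(eP' (x + d)) // addrC addKr gtr0_norm.
have germL1 x : x < L1 -> germ b1 x.
  move=> xL; exists (L1 - x); first by rewrite subr_gt0.
  by move=> y _; rewrite ltr_norml => /andP[_ yx]; apply: gL1; lra.
have germL2 x : L2 < x -> germ b2 x.
  move=> xL; exists (x - L2); first by rewrite subr_gt0.
  by move=> y _; rewrite ltr_norml => /andP[yx _]; apply: gL2; lra.
apply: contrapT => b12.
(* If the ends differed, [E] would have a supremum, but the germ there equals [b1] and carries [E]
   beyond it. *)
pose E : set R := fun x => forall y, y <= x -> germ b1 y.
have supE : has_sup E.
  split; first by exists (L1 - 1) => y yL; apply: germL1; lra.
  exists (L2 + 1) => x Ex; rewrite leNgt; apply/negP => Lx; apply: b12.
  by apply: (@germ_uniq _ _ x); [exact: Ex | apply: germL2; lra].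
have [b [e e0 eP]] := g_const (sup E).
have [d d0 dP] := germ_near b (sup E) (ex_intro2 _ _ e e0 eP).
have [x Ex xE] := sup_adherent d0 supE.
have bb1 : b = b1.
  apply: (@germ_uniq _ _ x); last exact: Ex.
  apply: dP; have := ub_le_sup (proj2 supE) Ex.
  by rewrite ltr_norml => ?; apply/andP; split; lra.
have : E (sup E + d / 2).
  move=> y yd; have [yx | xy] := leP y x; first exact: Ex.
  by rewrite -bb1; apply: dP; rewrite ltr_norml; apply/andP; split; lra.
by move/(ub_le_sup (proj2 supE)); lra.
Qed.

(** * The degree near infinity *)

Lemma compl_basis_far (R : realFieldType) n (A : 'M[R]_n) :
  exists2 L, 0 < L & forall y, L < `|y| -> forall J s (u : 'cV[R]_n),
    compl_basis (y%:M - A) J *m u = const_mx s -> 0 <= s ->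
    forall i, `|(if i \in J then y else 1) * u i 0 - s| <= s / 2.
Proof.
pose C := \sum_i \sum_k `|A i k|.
have C0 : 0 <= C by do 2!apply: sumr_ge0 => ? _.
have AC i k : `|A i k| <= C.
  rewrite /C (bigD1 i) //= (bigD1 k) //= -addrA lerDl addr_ge0 //.
    by apply: sumr_ge0 => ? _.
  by do 2!apply: sumr_ge0 => ? _.
(* With [m] the sum of the [|u k|] over [J], each error is at most C m, and |y| m <= n (s + C m).
   The factor 3 then yields 2 C m <= s. *)
exists (3 * n%:R * C + 1).
  by rewrite ltr_wpDl ?ltr01 // !mulr_ge0.
move=> y yL J s u Bu s0 i.
have n0 : 0 < n%:R :> R by rewrite ltr0n; case: (n) i => [[]|].
pose m := \sum_(k in J) `|u k 0|.
have m0 : 0 <= m by apply: sumr_ge0.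
have ineq j : `|(if j \in J then y else 1) * u j 0 - s| <= C * m.
  have -> : (if j \in J then y else 1) * u j 0 - s = \sum_(k in J) A j k * u k 0.
    have /matrixP/(_ j 0) := Bu.
    rewrite mulmx_compl_basis mulmxBl mul_scalar_mx !mxE => <-.
    rewrite (big_mkcond (fun k => k \in J)) /=.
    rewrite (eq_bigr (fun k => if k \in J then A j k * u k 0 else 0)); last first.
      by move=> k _; rewrite !mxE; case: (k \in J); rewrite ?mulr0.
    by case: (j \in J); rewrite ?mulr0; lra.
  rewrite (le_trans (ler_norm_sum _ _ _)) // /m mulr_sumr.
  by apply: ler_sum => k _; rewrite normrM ler_wpM2r.
apply: le_trans (ineq i) _.
have : `|y| * m <= n%:R * (s + C * m).
  rewrite /m mulr_sumr -/m.
  apply: (@le_trans _ _ (\sum_(k in J) (s + C * m))).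
    apply: ler_sum => k kJ; have := ineq k; rewrite kJ -normrM => yk.
    by have := ler_normD (y * u k 0 - s) s; rewrite subrK (ger0_norm s0); lra.
  rewrite sumr_const -[_ *+ #|J|]mulr_natl ler_wpM2r ?addr_ge0 ?mulr_ge0 // ler_nat.
  by rewrite -[X in (_ <= X)%N]card_ord max_card.
move=> ym; rewrite -(ler_pM2l n0).
have : (3 * n%:R * C + 1) * m <= `|y| * m by rewrite ler_wpM2r // ltW.
nra.
Qed.

Lemma col_kernel_of_det0 (F : fieldType) n (B : 'M[F]_n) :
  \det B = 0 -> exists2 v : 'cV[F]_n, v != 0 & B *m v = 0.
Proof.
move=> B0; have /det0P[v v0 vB] : \det B^T == 0 by rewrite det_tr B0.
exists v^T; first by apply: contra v0 => /eqP v0; rewrite -[v]trmxK v0 trmx0.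
by rewrite -[B]trmxK -trmx_mul vB trmx0.
Qed.

Lemma det_neq0_of_injective (F : fieldType) n (B : 'M[F]_n) :
  (forall v : 'cV[F]_n, B *m v = 0 -> v = 0) -> \det B != 0.
Proof.
move=> injB; apply/eqP => /col_kernel_of_det0[v v0 /injB]; exact/eqP.
Qed.

(** Quantifying over [q] makes the degree depend on [C] alone, so that it can be computed with a
    different [q] for each [C]. *)
Definition lcp_degree (R : realType) n (C : 'M[R]_n) : bool :=
  `[< exists2 q, lcp_nondegenerate C q & odd #|lcp_solutions C q| >].

Lemma lcp_degreeE (R : realType) n (C : 'M[R]_n) q :
  (forall J, compl_basis C J \in unitmx) -> lcp_nondegenerate C q ->
  lcp_degree C = odd #|lcp_solutions C q|.
Proof.
move=> unitB ndq; apply/asboolP/idP => [[q' ndq'] | oddq]; last by exists q.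
by rewrite (odd_lcp_solutions unitB ndq' ndq).
Qed.

(** In [compl_basis_far], [s = 0] gives invertibility and [s = 1] the signs of the solutions. For
    [y] far below 0, q = 1 gives negative entries on [J], so only the empty set counts; for [y] far
    above 0, q = -1 gives only negative entries. *)
Lemma lcp_degree_at_infty (R : realType) n (A : 'M[R]_n) : (0 < n)%N ->
  exists L, forall y, (y < - L -> lcp_degree (y%:M - A) = true) /\
                      (L < y -> lcp_degree (y%:M - A) = false).
Proof.
move=> n0; have [L L0 LP] := compl_basis_far A; exists L => y.
suff far : L < `|y| -> lcp_degree (y%:M - A) = (y < 0).
  split=> yL; rewrite far.
  - by apply/idP; lra.
  - by rewrite ltr0_norm; lra.
  - by apply/negbTE; rewrite -leNgt; lra.
  - by rewrite gtr0_norm; lra.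
move=> yL; have y0 : y != 0 by rewrite -normr_gt0 (lt_trans L0).
have unitB J : compl_basis (y%:M - A) J \in unitmx.
  rewrite unitmxE unitfE; apply: det_neq0_of_injective => u Bu.
  apply/matrixP => i j; rewrite ord1 mxE; apply/eqP.
  have := LP y yL J 0 u Bu (lexx 0) i.
  rewrite subr0 mul0r normr_le0 mulf_eq0 => /orP[|//].
  by case: ifP; rewrite ?(negbTE y0) ?oner_eq0.
pose u J := invmx (compl_basis (y%:M - A) J) *m const_mx 1 : 'cV[R]_n.
have u_sgn (J : {set 'I_n}) i : 0 < (if i \in J then y else 1) * u J i 0.
  have := LP y yL J 1 (u J) (mulKVmx (unitB J) _) ler01 i.
  by rewrite ler_norml; move: (_ * u J i 0) => w /andP[w1 _]; lra.
have nd1 : lcp_nondegenerate (y%:M - A) (const_mx 1).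
  by move=> J i; have := lt0r_neq0 (u_sgn J i); rewrite mulf_eq0 negb_or => /andP[].
have [y_lt0 | y_ge0] := ltP y 0.
  rewrite (lcp_degreeE unitB nd1) (_ : lcp_solutions _ _ = [set finset.set0]%SET) ?cards1 //.
  apply/setP => J; rewrite !inE; apply/forallP/eqP => [uJ | -> i].
    apply/setP => i; rewrite inE; apply/negbTE/negP => iJ.
    by have := u_sgn J i; rewrite iJ nmulr_rgt0 // ltNge ltW // uJ.
  by have := u_sgn finset.set0 i; rewrite inE mul1r.
have y_gt0 : 0 < y by rewrite lt_def y0.
have uN J : invmx (compl_basis (y%:M - A) J) *m const_mx (- 1) = - u J.
  by rewrite -mulmxN; congr (_ *m _); apply/matrixP => i j; rewrite !mxE.
have ndN : lcp_nondegenerate (y%:M - A) (const_mx (- 1)).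
  by move=> J i; rewrite uN mxE oppr_eq0; apply: nd1.
rewrite (lcp_degreeE unitB ndN) (_ : lcp_solutions _ _ = finset.set0) ?cards0 //.
apply/setP => J; rewrite !inE; apply/negbTE/forallPn; exists (Ordinal n0).
rewrite uN mxE oppr_gt0 -leNgt ltW //.
have := u_sgn J (Ordinal n0); case: ifP => _; last by rewrite mul1r.
by rewrite pmulr_rgt0.
Qed.

(** * Crossing an eigenvalue of a single principal submatrix *)

Lemma pareto_iff_same_sign (R : realType) n (A : 'M[R]_n) x J (p : 'cV[R]_n) :
  J != finset.set0 ->
  (forall K, \det (compl_basis (x%:M - A) K) = 0 -> K = J) ->
  compl_basis (x%:M - A) J *m p = 0 -> (forall i, p i 0 != 0) ->
  is_pareto_eigenvalue A x <-> (forall i, 0 < p i 0) \/ (forall i, p i 0 < 0).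
Proof.
move=> J0 uniq0 Bp p0; split; last first.
  case=> [p_gt0 | p_lt0]; first exact: pareto_of_compl_basis Bp p_gt0.
  apply: (@pareto_of_compl_basis _ _ _ _ J (- p)) => //.
    by rewrite mulmxN Bp oppr0.
  by move=> i; rewrite mxE oppr_gt0.
move=> /compl_basis_of_pareto[K [v [v0 [k kK vk] Bv]]].
have KJ : K = J.
  apply: uniq0; apply/eqP; apply: contraLR isT => /= B0.
  have v_eq0 : v = 0.
    rewrite -[v](@mulKmx _ _ _ (compl_basis (x%:M - A) K)) ?Bv ?mulmx0 //.
    by rewrite unitmxE unitfE.
  by rewrite v_eq0 mxE ltxx in vk.
rewrite {K}KJ in kK Bv.
pose c := v k 0 / p k 0.
(* The kernel of B_J is a line: v - c p vanishes at [k], so the invertible basis at [flip J k]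
   annihilates it too. *)
have vE : v = c *: p.
  have wk : (v - c *: p) k 0 = 0 by rewrite !mxE /c divfK ?subrr.
  have Bw : compl_basis (x%:M - A) (flip J k) *m (v - c *: p) = 0.
    rewrite mulmx_compl_basis_flip ?mulmxBr -?scalemxAr ?Bv ?Bp ?scaler0 ?subrr //.
    by move=> j; rewrite ord1.
  have unitB : compl_basis (x%:M - A) (flip J k) \in unitmx.
    rewrite unitmxE unitfE; apply/eqP => /uniq0/eqP.
    by rewrite (negbTE (flip_neq J k)).
  by apply/eqP; rewrite -subr_eq0 -[_ - _](mulKmx unitB) Bw mulmx0.
have c0 : c != 0 by rewrite mulf_neq0 ?invr_eq0 // lt0r_neq0.
have cp i : 0 < c * p i 0.
  by rewrite lt_def mulf_neq0 //=; have := v0 i; rewrite vE mxE.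
have [c_gt0 | c_lt0] := ltP 0 c; [left | right] => i; have := cp i.
  by rewrite pmulr_rgt0.
by rewrite nmulr_rgt0 // lt_neqAle c0.
Qed.

(* [r J] says that the determinant of [B_J] has a (simple) root at the point
   being crossed, [c J i] is the sign pattern of the solution at [J], [rQ] and
   [cQ] are the same data for the polynomial vanishing at the Pareto
   eigenvalues, and [s] is the side of the point. *)
Lemma crossing_invariance (R : realDomainType) (T I : finType) (r : pred T)
    (c : T -> I -> R) (rQ : bool) (cQ : R) (i0 : I) :
  (forall J K, r J -> r K -> J = K) -> cQ != 0 ->
  (rQ <-> exists2 J, r J & (forall i, 0 < c J i) \/ (forall i, c J i < 0)) ->
  let G s := odd #|[pred J | [forall i, 0 < s ^+ r J * c J i]]| (+)
             (s ^+ rQ * cQ < 0) in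
  G 1 = G (- 1).
Proof.
move=> r_uniq cQ0 rQP G; rewrite {}/G.
have [[J0 rJ0] | /forallNP nor] := pselect (exists J, r J); last first.
  have -> : rQ = false by apply/negbTE/negP => /rQP[J rJ]; case: (nor J).
  congr (odd _ (+) _); apply: eq_card => J; rewrite !inE.
  by have /negP/negbTE -> := nor J.
pose S s := [pred J | [forall i, 0 < s ^+ r J * c J i]].
(* Only the term of [J0] depends on the side. It changes exactly when [c J0] has constant sign,
   which is when the factor with [rQ] changes sign. *)
have SE s : odd #|S s| = [forall i, 0 < s * c J0 i] (+) odd #|[predD1 S 1 & J0]|.
  rewrite (cardD1 J0) oddD oddb !inE rJ0 expr1; congr (_ (+) odd _).
  apply: eq_card => J; rewrite !inE; case: (eqVneq J J0) => //= JJ0.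
  case: (boolP (r J)) => [rJ | _]; last by rewrite !expr0.
  by rewrite (r_uniq _ _ rJ rJ0) eqxx in JJ0.
rewrite (SE 1) (SE (- 1)).
have -> : [forall i, 0 < 1 * c J0 i] = [forall i, 0 < c J0 i].
  by apply: eq_forallb => i; rewrite mul1r.
have -> : [forall i, 0 < - 1 * c J0 i] = [forall i, c J0 i < 0].
  by apply: eq_forallb => i; rewrite mulN1r oppr_gt0.
have excl : ~~ ([forall i, 0 < c J0 i] && [forall i, c J0 i < 0]).
  apply/negP => /andP[/forallP/(_ i0) c1 /forallP/(_ i0)].
  by rewrite ltNge ltW.
have {}rQP : rQ = [forall i, 0 < c J0 i] || [forall i, c J0 i < 0].
  apply/idP/orP => [/rQP[J rJ] | cJ0].
    by rewrite (r_uniq _ _ rJ rJ0) => -[] cJ; [left|right]; apply/forallP.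
  by apply/rQP; exists J0 => //; case: cJ0 => /forallP; [left|right].
have -> : (1 ^+ rQ * cQ < 0) = (cQ < 0) by rewrite expr1n mul1r.
have -> : ((- 1) ^+ rQ * cQ < 0) = rQ (+) (cQ < 0).
  by case: rQ {rQP}; rewrite ?expr0 ?mul1r // expr1 mulN1r oppr_lt0; case: ltrgtP cQ0.
rewrite rQP; move: excl.
by case: [forall i, 0 < c J0 i] [forall i, c J0 i < 0] (odd _) (cQ < 0) => [] [] [] [].
Qed.

(** * Bases over the polynomial ring and their evaluation *)

Lemma map_compl_basis (F F' : nzRingType) (f : {rmorphism F -> F'}) n
    (C : 'M[F]_n) J :
  map_mx f (compl_basis C J) = compl_basis (map_mx f C) J.
Proof. by apply/matrixP => i j; rewrite !mxE; case: ifP; rewrite ?rmorph_nat. Qed.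

Lemma horner_compl_basis_char_poly (F : comNzRingType) n (A : 'M[F]_n) J y :
  map_mx (horner_eval y) (compl_basis (char_poly_mx A) J) =
  compl_basis (y%:M - A) J.
Proof.
rewrite map_compl_basis; congr compl_basis; apply/matrixP => i j.
by rewrite !mxE /= /horner_eval hornerD hornerN hornerMn hornerX hornerC.
Qed.

Lemma horner_det_compl_basis (F : comNzRingType) n (A : 'M[F]_n) J y :
  (\det (compl_basis (char_poly_mx A) J)).[y] = \det (compl_basis (y%:M - A) J).
Proof.
by rewrite -horner_compl_basis_char_poly det_map_mx.
Qed.

Lemma horner_adj_compl_basis (F : comNzRingType) n (A : 'M[F]_n) J
    (q : 'cV[F]_n) i y :
  ((\adj (compl_basis (char_poly_mx A) J) *m map_mx polyC q) i 0).[y] =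
  (\adj (compl_basis (y%:M - A) J) *m q) i 0.
Proof.
rewrite -horner_compl_basis_char_poly -map_mx_adj !mxE horner_sum; apply: eq_bigr => k _.
by rewrite !mxE hornerM hornerC.
Qed.

Lemma det_compl_basis_char_poly (R : realType) n (A : 'M[R]_n) J :
  \det (compl_basis (char_poly_mx A) J) = char_poly (principal_submx A J).
Proof.
rewrite det_compl_basis; congr determinant; apply/matrixP => i j.
by rewrite !mxE (inj_eq enum_val_inj).
Qed.

(** The boolean exponent treats simple roots and nonroots uniformly. *)
Lemma simple_root_factor (F : fieldType) (p : {poly F}) x :
  p != 0 -> (root p x -> mup x p = 1%N) ->
  exists2 E, p = ('X - x%:P) ^+ root p x * E & E.[x] != 0.
Proof.
move=> p0 mup1; case: (boolP (root p x)) => [px | px]; last by exists p; rewrite ?mul1r.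
have [m [E /implyP/(_ p0) Ex pE]] := multiplicity_XsubC p x.
exists E => //; rewrite mulrC {1}pE.
by move: (mup1 px); rewrite pE mupMr // mup_XsubCX eqxx => ->.
Qed.

(** * Local invariance for a principally simple matrix *)

Section PrincipallySimple.

Variables (R : realType) (n : nat) (A : 'M[R]_n).
Hypothesis hA : principally_simple A.

Let D J := \det (compl_basis (char_poly_mx A) J).

Lemma det_root_eigenvalue J x : root (D J) x ->
  J != finset.set0 /\ eigenvalue (principal_submx A J) x.
Proof.
rewrite eigenvalue_root_char -det_compl_basis_char_poly => Dx; split=> //.
apply: contraTneq Dx => ->.
by rewrite /D compl_basis_set0 det1 /root hornerC oner_eq0.
Qed.

Lemma det_root_uniq J K x : root (D J) x -> root (D K) x -> J = K.
Proof.
move=> /det_root_eigenvalue[J0 Jx] /det_root_eigenvalue[K0 Kx].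
apply: contrapT => /eqP JK; apply: (hA.2 J K J0 K0 JK).
by exists x.
Qed.

Lemma det_factor J x :
  exists2 E, D J = ('X - x%:P) ^+ root (D J) x * E & E.[x] != 0.
Proof.
apply: simple_root_factor.
  by rewrite /D det_compl_basis_char_poly monic_neq0 ?char_poly_monic.
move=> /det_root_eigenvalue[J0 Jx]; rewrite /D det_compl_basis_char_poly.
exact: hA.1.
Qed.

Lemma pareto_det_root x : is_pareto_eigenvalue A x -> exists J, root (D J) x.
Proof.
move=> /compl_basis_of_pareto[J [v [_ [k _ vk] Bv]]]; exists J.
rewrite /root horner_det_compl_basis; apply: contraLR isT => /= B0.
have v0 : v = 0.
  rewrite -[v](@mulKmx _ _ _ (compl_basis (x%:M - A) J)) ?Bv ?mulmx0 //.
  by rewrite unitmxE unitfE.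
by rewrite v0 mxE ltxx in vk.
Qed.

(** Near [x], every relevant sign is a constant, times the sign of y - x where the polynomial has a
    simple root at [x]. The sum is thus [G (Num.sg (y - x))], and [crossing_invariance] equates the
    two sides. *)
Lemma degree_pareto_locally_const (P : seq R) x : (0 < n)%N -> uniq P ->
  (forall y, y \in P <-> is_pareto_eigenvalue A y) ->
  exists b, exists2 e, 0 < e & forall y, y != x -> `|y - x| < e ->
    lcp_degree (y%:M - A) (+) ((\prod_(mu <- P) ('X - mu%:P)).[y] < 0) = b.
Proof.
move=> n0 uniqP PP.
have [E DE E0] : exists2 E : {set 'I_n} -> {poly R},
    forall J, D J = ('X - x%:P) ^+ root (D J) x * E J & forall J, (E J).[x] != 0.
  have /choice[E EP] J : exists E, D J = ('X - x%:P) ^+ root (D J) x * E /\ E.[x] != 0.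
    by have [E ? ?] := det_factor J x; exists E.
  by exists E => J; have [] := EP J.
have [Q' QE Q'0] : exists2 Q', \prod_(mu <- P) ('X - mu%:P) =
    ('X - x%:P) ^+ (x \in P) * Q' & Q'.[x] != 0.
  case: (boolP (x \in P)) => xP.
    exists (\prod_(mu <- rem x P) ('X - mu%:P)); first by rewrite (big_rem x).
    by rewrite -/(root _ x) root_prod_XsubC mem_rem_uniq // inE eqxx.
  exists (\prod_(mu <- P) ('X - mu%:P)); first by rewrite mul1r.
  by rewrite -/(root _ x) root_prod_XsubC.
have D0E J : (\det (compl_basis (x%:M - A) J) = 0) <-> root (D J) x.
  by rewrite /root horner_det_compl_basis; split=> /eqP.
(* As a basis may be singular at [x], genericity is imposed through the rows of the adjugates, which
   are nonzero because at most one basis is singular there. *)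
have [|q q0] := @exists_generic_vector _ _ _ (fun e : {set 'I_n} * 'I_n =>
    row e.2 (\adj (compl_basis (x%:M - A) e.1))).
  move=> [J i]; apply: adj_compl_basis_row_neq0 => K /D0E Jx /D0E Kx.
  exact: (det_root_uniq Jx).
pose N J i := (\adj (compl_basis (char_poly_mx A) J) *m map_mx polyC q) i 0.
have N0 J i : (N J i).[x] != 0.
  by have := q0 (J, i); rewrite -row_mul mxE horner_adj_compl_basis.
pose ps := Q' :: [seq E J | J <- enum {set 'I_n}] ++
           [seq N e.1 e.2 | e <- enum {: {set 'I_n} * 'I_n}].
have [|e e0 eP] := @sgr_horner_near _ ps x.
  move=> p; rewrite inE mem_cat => /or3P[/eqP -> // | /mapP[J _ ->] // |].
  by move=> /mapP[[J i] _ ->].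
(* The sign near [x] of entry [i] of the solution at [J], without the factor y - x of the
   determinant. *)
pose c J i := Num.sg (E J).[x] * Num.sg (N J i).[x].
have sg_c J : root (D J) x -> is_pareto_eigenvalue A x <->
    (forall i, 0 < c J i) \/ (forall i, c J i < 0).
  move=> Jx; have [J0 _] := det_root_eigenvalue Jx.
  pose p := \adj (compl_basis (x%:M - A) J) *m q.
  have NE i : (N J i).[x] = p i 0 by rewrite /N horner_adj_compl_basis.
  have Bp : compl_basis (x%:M - A) J *m p = 0.
    by rewrite mulmxA mul_mx_adj (D0E J).2 // mul_scalar_mx scale0r.
  have uniq0 K : \det (compl_basis (x%:M - A) K) = 0 -> K = J.
    by move=> /D0E Kx; apply: det_root_uniq Kx Jx.
  rewrite (pareto_iff_same_sign J0 uniq0 Bp) => [|i]; last by rewrite -NE N0.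
  have [EJ | EJ | /eqP] := ltrgtP (E J).[x] 0; last by rewrite (negbTE (E0 J)).
    have cE i : c J i = - Num.sg (p i 0) by rewrite /c NE ltr0_sg // mulN1r.
    by split=> -[] pi; [right | left | right | left] => i; have := pi i;
       rewrite cE ?oppr_gt0 ?oppr_lt0 ?sgr_gt0 ?sgr_lt0.
  have cE i : c J i = Num.sg (p i 0) by rewrite /c NE gtr0_sg // mul1r.
  by split=> -[] pi; [left | right | left | right] => i; have := pi i;
     rewrite cE ?sgr_gt0 ?sgr_lt0.
pose G s := odd #|[pred J | [forall i, 0 < s ^+ root (D J) x * c J i]]| (+)
            (s ^+ (x \in P) * Num.sg Q'.[x] < 0).
have GN : G 1 = G (- 1).
  apply: (@crossing_invariance _ _ _ _ c _ _ (Ordinal n0)).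
  - by move=> J K Jx Kx; apply: det_root_uniq Jx Kx.
  - by rewrite sgr_eq0.
  - apply: (iff_trans (PP x)); split=> [Ax | [J Jx]]; last by rewrite -sg_c.
    by have [J Jx] := pareto_det_root Ax; exists J; rewrite -?sg_c.
exists (G 1), e => // y yx ye.
have sg_yx : Num.sg (y - x) = 1 \/ Num.sg (y - x) = - 1.
  by have := yx; rewrite -subr_eq0; case: sgrP => //; [left | right].
have -> : G 1 = G (Num.sg (y - x)) by case: sg_yx => ->.
have sgE J : Num.sg (D J).[y] = Num.sg (y - x) ^+ root (D J) x * Num.sg (E J).[x].
  rewrite {1}DE hornerM horner_exp !hornerE sgrM sgrX eP //.
  by rewrite inE mem_cat map_f ?mem_enum ?orbT.
have sgN J i : Num.sg (N J i).[y] = Num.sg (N J i).[x].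
  rewrite eP // inE mem_cat; apply/or3P/Or33.
  by apply/mapP; exists (J, i); rewrite ?mem_enum.
have sgQ : Num.sg (\prod_(mu <- P) ('X - mu%:P)).[y] =
           Num.sg (y - x) ^+ (x \in P) * Num.sg Q'.[x].
  by rewrite QE hornerM horner_exp !hornerE sgrM sgrX eP // inE eqxx.
have sgyx0 : Num.sg (y - x) != 0 by rewrite sgr_eq0 subr_eq0.
have detB0 J : \det (compl_basis (y%:M - A) J) != 0.
  by rewrite -horner_det_compl_basis -sgr_eq0 sgE mulf_neq0 ?expf_neq0 // sgr_eq0 E0.
have ndq : lcp_nondegenerate (y%:M - A) q.
  move=> J i; rewrite invmx_neq0 // -horner_adj_compl_basis -/(N J i).
  by rewrite -sgr_eq0 sgN sgr_eq0.
rewrite (@lcp_degreeE _ _ _ q) => [||//]; last by move=> J; rewrite unitmxE unitfE.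
congr (odd _ (+) _); last by rewrite -sgQ sgr_lt0.
rewrite -[RHS]cardsE; apply: eq_card => J; rewrite !inE; apply: eq_forallb => i.
rewrite invmx_gt0 ?num_real // -horner_det_compl_basis -horner_adj_compl_basis.
by rewrite -/(D J) -/(N J i) -sgr_gt0 sgrM sgE sgN mulrA.
Qed.

End PrincipallySimple.

(** * Comparison of the two ends of the line *)

Lemma sgr_prod_XsubC_at_infty (R : realDomainType) (s : seq R) :
  exists L, forall y,
    (y < - L -> Num.sg (\prod_(mu <- s) ('X - mu%:P)).[y] = (- 1) ^+ size s) /\
    (L < y -> Num.sg (\prod_(mu <- s) ('X - mu%:P)).[y] = 1).
Proof.
elim: s => [|mu s [L LP]].
  by exists 0 => y; rewrite big_nil hornerC sgr1.
exists (Num.max L `|mu|) => y; rewrite big_cons hornerM !hornerE sgrM /=.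
have [yL Ly] := LP y; rewrite ltrNr !gt_max.
split=> /andP[yL' ymu].
- rewrite yL; last by rewrite ltrNr.
  by rewrite ltr0_sg ?exprS //; have := ler_norm (- mu); rewrite normrN; lra.
- by rewrite Ly // mulr1 gtr0_sg //; have := ler_norm mu; lra.
Qed.

Local Open Scope classical_set_scope.

Theorem corollary3p3 (R : realType) (n : nat) (hn : (0 < n)%N) (A : 'M[R]_n)
    (hA : principally_simple A) :
  finite_set (pareto_spectrum A) /\
  (#|` fset_set (pareto_spectrum A)| = 1 %[mod 2])%N.
Proof.
(* The roots of [W] are the points where some basis is singular; they include all Pareto
   eigenvalues, which [P] lists. *)
pose W := \prod_J \det (compl_basis (char_poly_mx A) J).
have W0 : W != 0.
  apply/prodf_neq0 => J _.
  by rewrite det_compl_basis_char_poly monic_neq0 ?char_poly_monic.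
pose P := [seq x <- undup (rootsR W) | `[< is_pareto_eigenvalue A x >]].
have uniqP : uniq P by rewrite filter_uniq ?undup_uniq.
have PP y : y \in P <-> is_pareto_eigenvalue A y.
  rewrite mem_filter mem_undup -(roots_on_rootsR W0) in_itv /=; split=> [/andP[/asboolP]//|Ay].
  rewrite asboolT //=; have [J Jy] := pareto_det_root Ay.
  by rewrite /W (bigD1 J) //= rootM Jy.
have specE : pareto_spectrum A = [set` P].
  by apply/seteqP; split=> y /PP.
have finP : finite_set (pareto_spectrum A) by rewrite specE; apply: finite_seq.
split=> //.
have -> : fset_set (pareto_spectrum A) = [fset y in P]%fset.
  apply/fsetP => y; rewrite in_fset_set // specE !inE; apply/asboolP/idP => //.
rewrite card_fseq undup_id // modn2.
(* These are the end values of the degree plus the indicator of a negative product: near -oo the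
   degree is 1 and the product has the sign of (-1)^(size P); near +oo both terms vanish. *)
suff : true (+) odd (size P) = false by case: odd.
have [L LP] := lcp_degree_at_infty A hn.
have [M MP] := sgr_prod_XsubC_at_infty P.
apply: (eq_ends_of_punctured_const (L1 := - Num.max L M) (L2 := Num.max L M)
  (g := fun y => lcp_degree (y%:M - A) (+) ((\prod_(mu <- P) ('X - mu%:P)).[y] < 0))).
- by move=> x; apply: degree_pareto_locally_const.
- move=> y; rewrite ltrNr gt_max ![_ < - y]ltrNr => /andP[/(LP y).1 -> /(MP y).1 sgQ].
  by rewrite -sgr_lt0 sgQ -signr_odd; case: (odd _); rewrite ?ltrN10 ?ltr10.
- move=> y; rewrite gt_max => /andP[/(LP y).2 -> /(MP y).2 sgQ].
  by rewrite -sgr_lt0 sgQ ltr10.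
Qed.
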